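(* The limits $\lim_{k \rightarrow \infty} \frac{h(k,3)}{k}$ and $\lim_{k \rightarrow \infty} \frac{g(k,3)}{k}$ exist and satisfy $$\frac{53}{24} \le \lim_{k \rightarrow \infty} \frac{h(k,3)}{k} \le \frac{5}{2} \qquad\text{and}\qquad \frac{13}{6} \le \lim_{k \rightarrow \infty} \frac{g(k,3)}{k} \le \frac{12}{5}.$$
   Context: All graphs are finite, simple and undirected. For a graph $G$, $rep(G)$ is the largest number of vertices of $G$ that all have the same degree in $G$, and $maxrep(G)$ is the number of vertices of $G$ whose degree equals the maximum degree of $G$. For integers $k \ge 1$ and $d \ge 0$: $g(k,d)$ is the least nonnegative integer such that every graph with maximum degree at most $d$ and more than $g(k,d)$ vertices has an induced subgraph $H$ with $rep(H) \ge k$; $h(k,d)$ is the least nonnegative integer such that every graph with maximum degree at most $d$ and more than $h(k,d)$ vertices has an induced subgraph $H$ with $maxrep(H) \ge k$ (degrees being taken in $H$). Both are at most $(k-1)(d+1)$, hence finite. *)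

(* Defs.v *)
(* [boolp] is imported only where it is needed: the classical layer shadows
   names and notations of [finset]. *)
From mathcomp Require Import all_boot.

Set Implicit Arguments.
Unset Strict Implicit.
Unset Printing Implicit Defensive.

Local Open Scope nat_scope.

Record sgraph := SGraph {
  vertex :> finType;
  adj : rel vertex;
  adj_sym : symmetric adj;
  adj_irrefl : irreflexive adj }.

Section Graph.
Variable G : sgraph.

Definition deg (x : G) : nat := #|[set y : G | adj x y]|.

Definition maxdeg : nat := \max_(x : G) deg x.

Definition rep : nat :=
  \max_(A : {set G} | [forall x in A, forall y in A, deg x == deg y]) #|A|.

Definition maxrep : nat := #|[set x : G | deg x == maxdeg]|.

End Graph.

(* The subgraph of [G] induced by [A], as a graph on its own vertex type: degrees
   and maximum degree are then those of the subgraph. *)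
Section Induced.
Variables (G : sgraph) (A : {set G}).

Let iadj : rel {x : G | x \in A} := fun x y => adj (val x) (val y).

Let iadj_sym : symmetric iadj.
Proof. by move=> x y; apply: adj_sym. Qed.

Let iadj_irrefl : irreflexive iadj.
Proof. by move=> x; apply: adj_irrefl. Qed.

Definition induced : sgraph := SGraph iadj_sym iadj_irrefl.

End Induced.

Definition forces (phi : sgraph -> nat) (k d n : nat) : Prop :=
  forall G : sgraph, maxdeg G <= d -> n < #|G| ->
    exists A : {set G}, k <= phi (induced A).

Lemma maxrep_le_rep (G : sgraph) : maxrep G <= rep G.
Proof.
rewrite /rep /maxrep.
apply: (leq_bigmax_cond (F := fun A : {set G} => #|A|)).
apply/forall_inP => x; rewrite inE => /eqP ->.
by apply/forall_inP => y; rewrite inE => /eqP ->.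
Qed.

Lemma maxrep_indep (G : sgraph) (A : {set G}) :
  {in A &, forall x y, ~~ adj x y} -> maxrep (induced A) = #|A|.
Proof.
move=> indA.
have d0 (x : induced A) : deg x = 0.
  by apply/eqP; rewrite cards_eq0 -subset0; apply/subsetP => y;
    rewrite inE /= (negPf (indA _ _ (valP x) (valP y))).
have D0 : maxdeg (induced A) = 0 by rewrite /maxdeg big1.
rewrite /maxrep D0 (_ : [set x | _] = [set: induced A]); last first.
  by apply/setP => x; rewrite !inE d0.
by rewrite cardsT /= card_sig; apply: eq_card => x; rewrite !inE.
Qed.

(* An inclusion-maximal independent set [A] of [G] is dominating, hence
   #|G| <= #|A| * d.+1, and the graph induced by [A] has all degrees 0. *)
Lemma forces_maxrep (k d : nat) : forces maxrep k d (k.-1 * d.+1).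
Proof.
move=> G dG ltG.
pose indep (A : {set G}) := [forall x in A, forall y in A, ~~ adj x y].
have indep0 : indep set0 by apply/forall_inP => x; rewrite inE.
have [A /maxsetP [indA maxA] _] := maxset_exists indep0.
have indAP : {in A &, forall x y, ~~ adj x y}.
  by move=> x y xA yA; move/forall_inP: indA => /(_ x xA) /forall_inP; apply.
exists A; rewrite maxrep_indep //.
pose N (x : G) := x |: [set y | adj x y].
have cover : [set: G] \subset \bigcup_(x in A) N x.
  apply/subsetP => y _; apply/bigcupP.
  have [yA | yA] := boolP (y \in A); first by exists y; rewrite // !inE eqxx.
  have [/exists_inP [x xA xy] | /exists_inPn noadj] :=
    boolP [exists x in A, adj x y]; first by exists x; rewrite // !inE xy orbT.
  suff eqA : y |: A = A by rewrite -eqA setU11 in yA.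
  apply: maxA; last exact: subsetUr.
  apply/forall_inP => u; rewrite !inE => uA.
  apply/forall_inP => v; rewrite !inE => vA.
  case/orP: uA => [/eqP->|uA]; case/orP: vA => [/eqP->|vA].
  - by rewrite adj_irrefl.
  - by rewrite adj_sym noadj.
  - by rewrite noadj.
  - exact: indAP.
have cN x : #|N x| <= d.+1.
  rewrite cardsU1 inE adj_irrefl add1n ltnS.
  by apply: leq_trans dG; apply: (leq_bigmax (F := @deg G)).
have leG : #|G| <= #|A| * d.+1.
  rewrite -cardsT; apply: leq_trans (subset_leq_card cover) _.
  rewrite -sum_nat_const.
  apply: (leq_trans (n := \sum_(x in A) #|N x|)); last exact: leq_sum.
  elim/big_rec2: _ => [|x m B _ leB]; first by rewrite cards0.
  by rewrite (leq_trans (leq_card_setU _ _)) // leq_add2l.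
have := leq_trans ltG leG; rewrite ltn_pmul2r //.
by case: k {ltG}.
Qed.

Lemma forces_rep (k d : nat) : forces rep k d (k.-1 * d.+1).
Proof.
move=> G dG ltG; have [A kA] := forces_maxrep dG ltG.
by exists A; apply: leq_trans kA (maxrep_le_rep _).
Qed.

From mathcomp Require Import boolp.

Lemma forces_rep_ex (k d : nat) : exists n, `[< forces rep k d n >].
Proof. by exists (k.-1 * d.+1); apply/asboolP; apply: forces_rep. Qed.

Lemma forces_maxrep_ex (k d : nat) : exists n, `[< forces maxrep k d n >].
Proof. by exists (k.-1 * d.+1); apply/asboolP; apply: forces_maxrep. Qed.

(* [ex_minn] returns the least such [n] (specification [ex_minnP]); the value does
   not depend on the bound used to prove existence. Both functions vanish at
   [k = 0], outside the intended range [1 <= k]. *)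
Definition g_rep (k d : nat) : nat := ex_minn (forces_rep_ex k d).

Definition h_maxrep (k d : nat) : nat := ex_minn (forces_maxrep_ex k d).

(* Main.v *)
(* Write N for the number of vertices, n3 for the number of vertices of degree 3,
   and suppose that no induced subgraph has more than m vertices of its maximum
   degree (for h), respectively of any given degree (for g).

   A star forest W contains an independent set I and an induced matching on a
   vertex set J with 2|I| + |J| >= 2|W|; hence 2|W| <= 3m.  Let t be the least
   number of vertices whose deletion leaves a star forest, and let a be the largest
   number of vertices of degree 2 in an induced subgraph (of maximum degree at most
   2, in the case of h).  The bounds 5/2 and 12/5 follow from
     2 t <= a + n3  (h)    and    16 t <= N + 6 a + 6 n3  (g)
   since a, n3 <= m.  Both are proved by deleting vertices: a vertex whose deletion
   lowers n3 by 2 (for h) or 3 (for g) pays for itself, so one may assume that closed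
   neighbourhoods contain at most 1, respectively 2, vertices of degree 3.
   In the case of h, the vertices of degree 3 are then deleted to bound t, while a is
   bounded below by deleting one neighbour of each of them instead, a leaf if possible.
   In the case of g, a weight depending on the degrees decreases by enough at each
   deletion.

   The limits exist by Fekete's lemma, since k |-> h(k + 1, 3) and k |-> g(k + 1, 3)
   are superadditive: take disjoint unions of extremal graphs.  The lower bounds come
   from explicit graphs with 53 and 13 vertices. *)

Require Import Defs.
From mathcomp Require Import all_boot.
From mathcomp Require Import zify.

Set Implicit Arguments.
Unset Strict Implicit.
Unset Printing Implicit Defensive.

Local Open Scope nat_scope.

Lemma card_bigcup_leq (I T : finType) (P : pred I) (F : I -> {set T}) :
  #|\bigcup_(i | P i) F i| <= \sum_(i | P i) #|F i|.
Proof.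
elim/big_rec2: _ => [|i m C _ le]; first by rewrite cards0.
by rewrite (leq_trans (leq_card_setU _ _)) // leq_add2l.
Qed.

(** * Degrees inside a vertex set, star forests and weighted deletion *)

Section InducedDegrees.
Variable G : sgraph.
Implicit Types (A B W S U I J D : {set G}) (u v w x y z : G) (c : nat -> nat).

Definition nbr A x : {set G} := [set y in A | adj x y].

Definition dg A x : nat := #|nbr A x|.

Definition ofdeg A d : {set G} := [set x in A | dg A x == d].

Lemma in_nbr A x y : (y \in nbr A x) = (y \in A) && adj x y.
Proof. by rewrite inE. Qed.

Lemma in_ofdeg A d x : (x \in ofdeg A d) = (x \in A) && (dg A x == d).
Proof. by rewrite inE. Qed.

Lemma nbrS A B x : A \subset B -> nbr A x \subset nbr B x.
Proof.
by move=> /subsetP sAB; apply/subsetP => y; rewrite !in_nbr => /andP[/sAB-> ->].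
Qed.

Lemma dgS A B x : A \subset B -> dg A x <= dg B x.
Proof. by move=> sAB; apply/subset_leq_card/nbrS. Qed.

Lemma mem_nbrC A x y : x \in A -> y \in nbr A x -> x \in nbr A y.
Proof. by move=> xA; rewrite !in_nbr xA adj_sym => /andP[]. Qed.

Lemma nbr_neq A x y : y \in nbr A x -> y != x.
Proof.
by rewrite in_nbr => /andP[_ xy]; apply: contraTneq xy => ->; rewrite adj_irrefl.
Qed.

Lemma dg_gt0 A x y : y \in nbr A x -> 0 < dg A x.
Proof. by move=> yx; rewrite /dg (cardD1 y) yx. Qed.

Lemma nbrD1 A x v : nbr (A :\ v) x = nbr A x :\ v.
Proof. by apply/setP => y; rewrite !inE andbA. Qed.

Lemma dgD1 A x v : v \in A -> dg (A :\ v) x = dg A x - adj x v.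
Proof.
move=> vA; rewrite /dg nbrD1 [#|nbr A x|](cardsD1 v) in_nbr vA.
by case: (adj x v) => /=; lia.
Qed.

Lemma dg1_nbr A x y : dg A x = 1 -> y \in nbr A x -> nbr A x = [set y].
Proof.
move=> d1 yx; apply/esym/eqP; rewrite eqEcard sub1set yx cards1.
by rewrite -d1 leqnn.
Qed.

Lemma dg2_nbr A x y z :
  dg A x = 2 -> y \in nbr A x -> z \in nbr A x -> y != z -> nbr A x = [set y; z].
Proof.
move=> d2 yx zx neq; apply/esym/eqP; rewrite eqEcard subUset !sub1set yx zx.
by rewrite cards2 neq -[#|nbr A x|]/(dg A x) d2.
Qed.

Lemma dgU_sep A B x :
  {in A & B, forall y z, ~~ adj y z} -> x \in A -> dg (A :|: B) x = dg A x.
Proof.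
move=> sepAB xA; congr #|pred_of_set _|; apply/setP => y; rewrite !inE.
by have [yB|_] := boolP (y \in B); rewrite ?orbF // (negPf (sepAB x y xA yB)) !andbF.
Qed.

(* Every component is a star: this excludes triangles as well as paths on 4 vertices. *)
Definition star_forest W : Prop :=
  {in W &, forall x y, adj x y -> (dg W x <= 1) || (dg W y <= 1)}.

(** The deletion number of [B] is at most p/s. The scale [s] clears denominators, so that fractional
    charges stay in [nat]. *)
Definition star_del B s p : Prop :=
  exists W, [/\ W \subset B, star_forest W & s * #|B :\: W| <= p].

Lemma star_del_leq B s p q : p <= q -> star_del B s p -> star_del B s q.
Proof. by move=> lepq [W [sW fW le]]; exists W; split=> //; lia. Qed.

Lemma star_del_self B s p : star_forest B -> star_del B s p.
Proof. by move=> fB; exists B; split=> //; rewrite setDv cards0 muln0. Qed.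

(** All neighbours of [U] in [B] lie in [S], so no edge joins [U] to a star forest kept in
    [B :\: S]. The union of the two is again a star forest, and the extra deletions are those of
    [S :\: U]. *)
Lemma star_del_closed B S U s p :
    S \subset B -> U \subset S -> star_forest U ->
    {in U, forall u, nbr B u \subset S} ->
  star_del (B :\: S) s p -> star_del B s (p + s * #|S :\: U|).
Proof.
move=> sSB sUS fU clU [W [sW fW le]]; exists (W :|: U).
have sUB := subset_trans sUS sSB.
have sWB : W \subset B by apply: subset_trans sW (subsetDl _ _).
have WS x : x \in W -> x \notin S by move/(subsetP sW); rewrite inE => /andP[].
have noWU x y : x \in W -> y \in U -> ~~ adj y x.
  move=> xW yU; apply: contra (WS x xW) => yx; apply: (subsetP (clU y yU)).
  by rewrite in_nbr yx (subsetP sWB).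
have dW x : x \in W -> dg (W :|: U) x = dg W x.
  by apply: dgU_sep => y z yW zU; rewrite adj_sym noWU.
have dU x : x \in U -> dg (W :|: U) x = dg U x.
  by rewrite setUC; apply: dgU_sep => y z yU zW; rewrite noWU.
split; first by rewrite subUset sWB sUB.
  move=> x y; rewrite !inE => /orP[xW|xU] /orP[yW|yU] xy.
  - by rewrite !dW //; apply: fW.
  - by have := noWU x y xW yU; rewrite adj_sym xy.
  - by have := noWU y x yW xU; rewrite xy.
  - by rewrite !dU //; apply: fU.
have -> : B :\: (W :|: U) = ((B :\: S) :\: W) :|: (S :\: U).
  apply/setP => x; rewrite !inE.
  move/implyP: (WS x); move/implyP: (subsetP sSB x); move/implyP: (subsetP sUS x).
  by case: (x \in W); case: (x \in U); case: (x \in S); case: (x \in B).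
apply: leq_trans (leq_mul (leqnn s) (leq_card_setU _ _).1) _.
by rewrite mulnDr leq_add2r.
Qed.

Lemma star_del1 B v s p :
  v \in B -> star_del (B :\ v) s p -> star_del B s (p + s).
Proof.
move=> vB; have e : s = s * #|[set v] :\: set0| by rewrite setD0 cards1 muln1.
rewrite {3}e; apply: star_del_closed; rewrite ?sub1set ?sub0set //.
  by move=> x; rewrite in_set0.
by move=> x; rewrite inE.
Qed.

Definition pot c B : nat := \sum_(x in B) c (dg B x).

Lemma pot_del c B S :
    {homo c : i j / i <= j} -> S \subset B ->
  pot c (B :\: S) + \sum_(x in S) c (dg B x) <= pot c B.
Proof.
move=> mc sSB; rewrite /pot [X in _ <= X](big_setID S) /= (setIidPr sSB) addnC.
rewrite leq_add2l; apply: leq_sum => x _; apply/mc/dgS/subsetDl.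
Qed.

(** Exact accounting for one deletion: the weight of [v] goes, and each neighbour drops by one
    degree. Monotonicity makes the truncated subtraction exact. *)
Lemma pot_del1 c B v :
    {homo c : i j / i <= j} -> v \in B ->
  pot c (B :\ v) + c (dg B v)
    + \sum_(x in nbr B v) (c (dg B x) - c (dg B x).-1) = pot c B.
Proof.
move=> mc vB; rewrite /pot [RHS](big_setD1 v) //= [RHS]addnC -!addnA.
rewrite [in LHS](addnC (c _)) !addnA; congr (_ + _).
have e x : (x \in nbr B v) = (x \in B :\ v) && adj v x.
  rewrite !inE; have [->|] := eqVneq x v => //=.
  by rewrite adj_irrefl andbF.
rewrite [X in _ + X](eq_bigl _ _ e) big_mkcondr -big_split /=.
apply: eq_bigr => x _.
rewrite dgD1 // adj_sym; case: (adj v x); last by rewrite subn0 addn0.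
by rewrite subn1 subnKC // mc // leq_pred.
Qed.

(** A vertex of degree 2 between two others of degree 2 is deleted at a gain of 3 c(2) - 2 c(1).
    When none is left, every vertex of degree 2 has a leaf neighbour, so two adjacent ones span a
    path component on 4 vertices; it weighs 2 (c(1) + c(2)) and needs one deletion. If no two
    vertices of degree 2 are adjacent, [B] is a star forest. *)
Lemma star_del_maxdeg2 c B s :
    {homo c : i j / i <= j} -> s + 2 * c 1 <= 3 * c 2 -> s <= 2 * (c 1 + c 2) ->
    {in B, forall x, dg B x <= 2} ->
  star_del B s (pot c B).
Proof.
move=> mc c12 c21; have [n] := ubnP #|B|; elim: n B => // n IHn B ltB dB.
have ltD v : v \in B -> #|B :\ v| < n.
  by move=> vB; move: ltB; rewrite (cardsD1 v B) vB.
have dD S : {in B :\: S, forall x, dg (B :\: S) x <= 2}.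
  move=> x /setDP[xB _]; apply: leq_trans (dB x xB); apply/dgS/subsetDl.
have [/exists_inP[v]|/exists_inPn noA] :=
  boolP [exists v in ofdeg B 2, nbr B v \subset ofdeg B 2].
  rewrite in_ofdeg => /andP[vB /eqP dv] /subsetP nv.
  have := star_del1 vB (IHn _ (ltD v vB) (dD _)); apply: star_del_leq.
  rewrite -(pot_del1 mc vB) dv (eq_bigr (fun=> c 2 - c 1)) => [|x /nv].
    by rewrite sum_nat_const -/(dg B v) dv; lia.
  by rewrite in_ofdeg => /andP[_ /eqP->].
have leaf v : v \in ofdeg B 2 -> exists2 l, l \in nbr B v & dg B l = 1.
  move=> v2; have /subsetPn[l lv l2] := noA v v2; exists l => //.
  have /andP[lB _] : (l \in B) && adj v l by rewrite -in_nbr.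
  have vB : v \in B by move: v2; rewrite in_ofdeg => /andP[].
  move: l2; rewrite in_ofdeg lB /= => l2.
  by have := dg_gt0 (mem_nbrC vB lv); have := dB l lB; lia.
have [/exists_inP[u]|/exists_inPn noB] :=
  boolP [exists u in ofdeg B 2, ~~ [disjoint nbr B u & ofdeg B 2]].
  move=> u2 /pred0Pn[v /andP[/= vu v2]].
  have [l lu dl] := leaf u u2; have [m mv dm] := leaf v v2.
  have [uB /eqP du] := andP (etrans (esym (in_ofdeg _ _ _)) u2).
  have [vB /eqP dv] := andP (etrans (esym (in_ofdeg _ _ _)) v2).
  have lv : l != v by apply/eqP => e; rewrite e dv in dl.
  have mu : m != u by apply/eqP => e; rewrite e du in dm.
  have uv : u != v by rewrite eq_sym (nbr_neq vu).
  have nu : nbr B u = [set v; l] by apply: dg2_nbr => //; rewrite eq_sym.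
  have lB : l \in B by move: lu; rewrite in_nbr => /andP[].
  have mB : m \in B by move: mv; rewrite in_nbr => /andP[].
  have nl := dg1_nbr dl (mem_nbrC uB lu); have nm := dg1_nbr dm (mem_nbrC vB mv).
  have lm : l != m.
    by apply: contra_neq uv => e; apply/set1_inj; rewrite -nl -nm e.
  (* [S] is the path component l - u - v - m. Without [v] it is an edge and an isolated vertex. *)
  pose U := [set u; l; m]; pose S := v |: U.
  have vU : v \notin U.
    rewrite !inE eq_sym (negPf uv) eq_sym (negPf lv) eq_sym.
    by move: (nbr_neq mv) => ->.
  have sSB : S \subset B by rewrite !subUset !sub1set vB uB lB mB.
  have dU x : x \in U -> dg U x <= 1.
    move=> xU; have xB : x \in B by apply: (subsetP sSB); rewrite in_setU1 xU orbT.
    apply: leq_trans (_ : dg (B :\ v) x <= 1).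
      apply/dgS/subsetP => y yU; rewrite !inE (contraNneq _ vU) => [|<- //] /=.
      by rewrite (subsetP sSB) // in_setU1 yU orbT.
    rewrite dgD1 //; move: xU; rewrite !inE -orbA => /or3P[] /eqP->.
    - by rewrite du; move: vu; rewrite in_nbr => /andP[_ ->].
    - by rewrite dl leq_subr.
    - by rewrite dm leq_subr.
  have SU : S :\: U = [set v].
    rewrite setDUl setDv setU0; apply/eqP; rewrite eqEsubset subsetDl /=.
    by rewrite sub1set inE vU in_set1 eqxx.
  have ltS : #|B :\: S| < n.
    apply: leq_trans (ltD v vB); rewrite ltnS subset_leq_card //.
    by apply/setDS/subsetUl.
  have fU : star_forest U by move=> x y /dU-> _ _.
  have clU x : x \in U -> nbr B x \subset S.
    rewrite !inE -orbA => /or3P[] /eqP->; rewrite ?nu ?nl ?nm;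
    by rewrite ?subUset !sub1set !inE !eqxx ?orbT.
  have := star_del_closed sSB (subsetUr _ _) fU clU (IHn _ ltS (dD _)).
  apply: star_del_leq; rewrite SU cards1 muln1.
  apply: leq_trans (pot_del mc sSB); rewrite leq_add2l.
  have mU : m \notin [set u; l] by rewrite !inE negb_or mu eq_sym.
  have ul : u \notin [set l] by rewrite inE eq_sym (nbr_neq lu).
  rewrite (big_setU1 _ vU) /= /U setUC (big_setU1 _ mU) (big_setU1 _ ul) /= big_set1.
  rewrite du dv dl dm.
  clear -c12 c21; lia.
apply: star_del_self => x y xB yB xy.
apply: contraT; rewrite negb_or -!ltnNge => /andP[dx dy].
have x2 : x \in ofdeg B 2 by rewrite in_ofdeg xB eqn_leq dB.
have y2 : y \in ofdeg B 2 by rewrite in_ofdeg yB eqn_leq dB.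
have := noB x x2; rewrite negbK => /pred0P/(_ y) /=.
by rewrite y2 in_nbr yB xy.
Qed.

(** Stars are removed one at a time: the leaves [N] of a star with centre [a] go to [I], and one
    edge [a], [b] goes to [J]. The star has |N| + 1 vertices and contributes 2|N| + 2. Isolated
    vertices go to [I]. *)
Lemma star_forest_split W : star_forest W ->
  exists I J, [/\ I \subset W, J \subset W, {in I, forall x, dg I x = 0},
                  {in J, forall x, dg J x = 1} & 2 * #|W| <= 2 * #|I| + #|J|].
Proof.
have [n] := ubnP #|W|; elim: n W => // n IHn W ltW fW.
have [/exists_inP[a aW /existsP[b]]|noE] :=
  boolP [exists a in W, exists b, (b \in nbr W a) && (dg W b <= 1)]; last first.
  (* Each edge of a star forest has an end of degree at most 1, so here [W] has no edge at all. *)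
  exists W, set0; rewrite subxx sub0set cards0; split=> // [x xW|x|]; last by lia.
  apply/eqP; rewrite cards_eq0; apply/set0Pn => -[y yx]; case/negP: noE.
  have /andP[yW xy] : (y \in W) && adj x y by rewrite -in_nbr.
  case/orP: (fW x y xW yW xy) => d1; apply/exists_inP.
    by exists y => //; apply/existsP; exists x; rewrite d1 mem_nbrC.
  by exists x => //; apply/existsP; exists y; rewrite d1 yx.
  by rewrite inE.
move=> /andP[ba db].
have leaf y : y \in nbr W a -> nbr W y = [set a].
  move=> ya; have /andP[yW ay] : (y \in W) && adj a y by rewrite -in_nbr.
  have ay' := mem_nbrC aW ya.
  apply: (dg1_nbr _ ay'); apply/eqP; rewrite eqn_leq (dg_gt0 ay') andbT.
  case/orP: (fW a y aW yW ay) => // da; suff -> : y = b by [].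
  apply/set1P; rewrite -(dg1_nbr _ ba) //; apply/eqP.
  by rewrite eqn_leq da (dg_gt0 ba).
pose N := nbr W a; pose W' := W :\: (a |: N).
have sNW : N \subset W by apply/subsetP => y; rewrite in_nbr => /andP[].
have sW' : W' \subset W by apply: subsetDl.
have aN : a \notin N by rewrite in_nbr adj_irrefl andbF.
have sepW' x z : x \in W' -> z \in a |: N -> ~~ adj x z.
  rewrite !inE negb_or => /andP[/andP[xa xN] xW]; apply: contraTN => xz.
  rewrite negb_or; apply/andP; split.
    by apply: contraNneq xN => e; rewrite -e adj_sym xz xW.
  apply/negP => /andP[zW az]; move: xa; rewrite -in_set1 -(leaf z).
    by rewrite in_nbr xW adj_sym xz.
  by rewrite in_nbr zW.
have [|x y xW yW xy|I [J [sI sJ dI dJ leIJ]]] := IHn W'.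
- rewrite -ltnS; apply: leq_trans ltW; rewrite ltnS; apply/proper_card/properP.
  by split=> //; exists a => //; rewrite !inE eqxx.
- by case/orP: (fW x y (subsetP sW' x xW) (subsetP sW' y yW) xy) => d1;
    apply/orP; [left|right]; apply: leq_trans d1; apply: dgS.
exists (I :|: N), (J :|: [set a; b]).
have sab : [set a; b] \subset a |: N.
  by rewrite subUset !sub1set !in_setU1 eqxx ba orbT.
have disW A (C : {set G}) : A \subset W' -> C \subset a |: N -> #|A :|: C| = #|A| + #|C|.
  move=> sA sC; rewrite cardsU; suff -> : A :&: C = set0 by rewrite cards0 subn0.
  apply/setP => x; rewrite !inE; apply/negP => /andP[/(subsetP sA) xW /(subsetP sC)].
  by move: xW; rewrite !inE => /andP[/negPf->].
have sepI A (C : {set G}) : A \subset W' -> C \subset a |: N -> {in A & C, forall x z, ~~ adj x z}.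
  by move=> sA sC x z /(subsetP sA) xW /(subsetP sC) zN; apply: sepW'.
have dU A (C : {set G}) x : A \subset W' -> C \subset a |: N ->
    dg (A :|: C) x = if x \in A then dg A x else if x \in C then dg C x else dg (A :|: C) x.
  move=> sA sC; case: ifP => [|_]; first by apply: dgU_sep; apply: sepI.
  case: ifP => // xC; rewrite setUC; apply: dgU_sep => // y z yC zA.
  by rewrite adj_sym; apply: (sepI A C).
have sN' : N \subset a |: N by apply: subsetUr.
have abn : a != b by rewrite eq_sym; apply: nbr_neq ba.
split.
- by rewrite subUset sNW (subset_trans sI).
- by rewrite !subUset !sub1set aW (subset_trans sJ) // (subsetP sNW).
- move=> x; rewrite in_setU dU //; case: ifP => [/dI //|_ /= xN]; rewrite xN.
  apply/eqP; rewrite cards_eq0; apply/set0Pn => -[y]; rewrite in_nbr => /andP[yN xy].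
  have : y \in [set a] by rewrite -(leaf x xN) in_nbr xy (subsetP sNW).
  by rewrite inE => /eqP e; rewrite e (negPf aN) in yN.
- move=> x; rewrite in_setU dU //; case: ifP => [/dJ //|_ /= xab]; rewrite xab.
  have ab : adj a b by move: ba; rewrite in_nbr => /andP[].
  rewrite /dg; move: xab; rewrite !inE => /pred2P[]->.
    rewrite (_ : nbr _ _ = [set b]) ?cards1 //; apply/setP => y; rewrite !inE.
    by have [->|_] := eqVneq y b; rewrite ?ab ?orbT // orbF; case: eqP => // ->; rewrite adj_irrefl.
  rewrite (_ : nbr _ _ = [set a]) ?cards1 //; apply/setP => y; rewrite !inE.
  by have [->|_] := eqVneq y a; rewrite ?(adj_sym b) ?ab //=;
    case: eqP => // ->; rewrite adj_irrefl.
rewrite (disW _ _ sI sN') (disW _ _ sJ sab) cards2 abn.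
have -> : #|W| = #|W'| + (#|N| + 1).
  rewrite -(cardsID (a |: N) W) addnC; congr (_ + _).
  by rewrite (setIidPr _) ?cardsU1 ?aN ?subUset ?sub1set ?aW // addnC.
clear -leIJ; lia.
Qed.

(** * Deletion bound for [maxrep] *)

Lemma ofdeg3_del1 B x : {in B, forall y, dg B y <= 3} -> x \in B ->
  #|ofdeg (B :\ x) 3| + #|ofdeg B 3 :&: (x |: nbr B x)| = #|ofdeg B 3|.
Proof.
move=> dB xB; rewrite -(cardsID (x |: nbr B x) (ofdeg B 3)) addnC; congr (_ + _).
congr #|pred_of_set _|; apply/setP => y; rewrite in_ofdeg in_setD1.
rewrite [RHS]in_setD in_setU1 in_ofdeg in_nbr negb_or; have [->|_] //= := eqVneq y x.
have [yB|//] := boolP (y \in B); rewrite dgD1 // adj_sym /=.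
have := dB y yB; case: (adj x y) => /=; last by rewrite subn0.
by case: (dg B y) => [|[|[|[|k]]]].
Qed.

Lemma star_del_setD B S s p :
  S \subset B -> star_del (B :\: S) s p -> star_del B s (p + s * #|S|).
Proof.
move=> sSB; rewrite -{2}[S]setD0; apply: star_del_closed; rewrite ?sub0set //.
  by move=> x; rewrite in_set0.
by move=> x; rewrite in_set0.
Qed.

Lemma pot_gt1 B : {in B, forall x, dg B x <= 2} ->
  pot (fun d => 1 < d) B = #|ofdeg B 2|.
Proof.
move=> dB; rewrite /pot -sum1_card [RHS](eq_bigl _ _ (in_ofdeg B 2)) big_mkcondr.
by apply: eq_bigr => x /dB; case: (dg B x) => [|[|[|d]]].
Qed.

(** By sparsity, vertices of degree 3 are non-adjacent and have no common neighbour. Deleting one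
    neighbour [f v] of each such [v] turns [v] into a vertex of degree 2. The old vertices of degree
    2 lost on the way are charged to those adjacent to [V3], which are exactly the ones that
    [B :\: V3] does not keep at degree 2. *)
Lemma ofdeg2_induced B :
    {in B, forall x, dg B x <= 3} ->
    {in B, forall x, #|ofdeg B 3 :&: (x |: nbr B x)| <= 1} ->
  exists A, [/\ A \subset B, {in A, forall x, dg A x <= 2} &
    #|ofdeg B 3| + #|ofdeg (B :\: ofdeg B 3) 2| <= #|ofdeg A 2|].
Proof.
move=> dB sparse; set V3 := ofdeg B 3 in sparse *; set V2 := ofdeg B 2.
have V3B v : v \in V3 -> v \in B by rewrite in_ofdeg => /andP[].
have V3d v : v \in V3 -> dg B v = 3 by rewrite in_ofdeg => /andP[_ /eqP].
have uniqV3 x v w : v \in V3 -> w \in V3 -> x \in nbr B v -> x \in nbr B w -> v = w.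
  move=> vV wV xv xw; have xB : x \in B by move: xv; rewrite in_nbr => /andP[].
  apply: (card_le1_eqP (sparse x xB)); rewrite in_setI ?vV ?wV in_setU1.
    by rewrite (mem_nbrC (V3B _ wV) xw) orbT.
  by rewrite (mem_nbrC (V3B _ vV) xv) orbT.
have indV3 v w : v \in V3 -> w \in V3 -> w \notin nbr B v.
  move=> vV wV; apply/negP => wv; have := nbr_neq wv; rewrite eq_sym => /eqP; apply.
  apply: (card_le1_eqP (sparse w (V3B w wV))).
    by rewrite inE wV setU11.
  by rewrite inE vV in_setU1 (mem_nbrC (V3B _ vV) wv) orbT.
have [f fN fleaf] : exists2 f : G -> G, {in V3, forall v, f v \in nbr B v} &
    {in V3, forall v, dg B (f v) != 1 -> {in nbr B v, forall y, dg B y != 1}}.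
  (* A leaf is preferred, because deleting it changes only the degree of [v]. *)
  pose f v := if [pick y in nbr B v | dg B y == 1] is Some y then y
              else odflt v [pick y in nbr B v].
  exists f => v vV; rewrite /f; case: pickP => [y /andP[yv /eqP d1]|noleaf] //=.
  - case: pickP => [y yv|none] //=.
    by have := V3d v vV; rewrite /dg (eq_card0 none).
  - by rewrite d1.
  - by move=> _ y yv; have := noleaf y; rewrite yv /= => ->.
pose D := f @: V3; pose A := B :\: D.
have fV3 v : v \in V3 -> f v \notin V3.
  by move=> vV; apply: contraL (fN v vV) => fV; apply: indV3.
have V3A v : v \in V3 -> v \in A.
  move=> vV; rewrite inE V3B // andbT; apply/imsetP => -[w wV e].
  by move: (fV3 w wV); rewrite -e vV.
have dV3 v : v \in V3 -> dg A v = 2.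
  move=> vV; have := V3d v vV; rewrite /dg (cardsD1 (f v)) fN // => -[<-].
  congr #|pred_of_set _|; apply/setP => y; rewrite in_nbr in_setD1 in_setD in_nbr.
  have [yB|] := boolP (y \in B); rewrite ?andbF //= andbT.
  have [vy|] := boolP (adj v y); rewrite ?andbF // !andbT; congr (~~ _).
  apply/imsetP/eqP => [[w wV e]|->]; last by exists v.
  by rewrite e; congr f; apply: (@uniqV3 y) => //; [rewrite e fN | rewrite in_nbr yB].
have V2A x : x \in V2 -> x \notin D -> [disjoint nbr B x & D] -> x \in ofdeg A 2.
  rewrite [x \in V2]in_ofdeg => /andP[xB /eqP d2] xD dis.
  rewrite in_ofdeg inE xB xD -d2 /=; apply/eqP; congr #|pred_of_set _|.
  apply/setP => y; rewrite !in_nbr inE; case: (boolP (y \in D)) => //= yD.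
  apply/esym/negbTE; apply/negP => yx; move/pred0P: dis => /(_ y) /=.
  by rewrite yD andbT in_nbr yx.
exists A; split; first exact: subsetDl.
  move=> x xA; have xB : x \in B by move: xA; rewrite inE => /andP[].
  have [xV|xV] := boolP (x \in V3); first by rewrite dV3.
  apply: leq_trans (dgS x (subsetDl B D)) _.
  by move: xV (dB x xB); rewrite in_ofdeg xB /= => d3; rewrite leq_eqVlt (negPf d3).
set Z := ofdeg (B :\: V3) 2.
have ZP z : z \in Z -> z \in V2 /\ nbr B z :&: V3 = set0.
  rewrite in_ofdeg inE => /andP[/andP[zV zB] /eqP d2].
  have d3 : dg B z = 2.
    apply/eqP; rewrite eqn_leq -{2}d2 dgS ?subsetDl // andbT -ltnS ltn_neqAle dB //.
    by move: zV; rewrite in_ofdeg zB => ->.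
  split; first by rewrite in_ofdeg zB d3.
  have e : nbr (B :\: V3) z = nbr B z.
    by apply/eqP; rewrite eqEcard nbrS ?subsetDl // -/(dg B z) d3 -[#|_|]/(dg _ z) d2.
  apply/setP => y; rewrite in_set0 in_setI -e in_nbr in_setD.
  by case: (y \in V3) => //; rewrite andbF.
have sZ : Z \subset V2 by apply/subsetP => z /ZP[].
(* If [f v] is a leaf, nothing is lost. Otherwise [v] has no leaf neighbour, so its three neighbours
   all lie in [V2]; as [f v] has degree 2, its closed neighbourhood has only 3 vertices. *)
pose lost v := V2 :&: (f v |: nbr B (f v)).
have card_lost v : v \in V3 -> #|lost v| <= #|nbr B v :&: V2|.
  move=> vV; have fv := fN v vV; have /andP[fB _] : (f v \in B) && adj v (f v).
    by rewrite -in_nbr.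
  have [d1|d1] := eqVneq (dg B (f v)) 1.
    rewrite (_ : lost v = set0) ?cards0 //; apply/setP => x.
    rewrite in_setI in_setU1 (dg1_nbr d1 (mem_nbrC (V3B v vV) fv)) !inE.
    have [->|_] := eqVneq x (f v); first by rewrite d1 andbF.
    by have [->|_] := eqVneq x v; rewrite ?andbF // V3d // andbF.
  have N2 y : y \in nbr B v -> y \in V2.
    move=> yv; have /andP[yB _] : (y \in B) && adj v y by rewrite -in_nbr.
    have d3 : dg B y != 3.
      by apply: contraTneq yv => d3; apply: indV3 => //; rewrite in_ofdeg yB d3.
    rewrite in_ofdeg yB; move: (fleaf v vV d1 y yv) (dB y yB) d3.
    have := dg_gt0 (mem_nbrC (V3B v vV) yv).
    by case: (dg B y) => [|[|[|[|d]]]].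
  have -> : nbr B v :&: V2 = nbr B v by apply/setIidPl/subsetP.
  rewrite -/(dg B v) V3d //; apply: leq_trans (subset_leq_card (subsetIr _ _)) _.
  rewrite cardsU1 -/(dg B (f v)).
  by move: (N2 _ fv); rewrite in_ofdeg => /andP[_ /eqP->]; case: (_ \notin _).
(* Double counting: a vertex of [V2] has at most one neighbour in [V3], and none if it lies in
   [Z]. *)
have card_nbrV2 : \sum_(v in V3) #|nbr B v :&: V2| <= #|V2 :\: Z|.
  rewrite (eq_bigr (fun v => \sum_(y in V2) adj v y)) => [|v vV]; last first.
    rewrite -sum1_card big_mkcond [RHS]big_mkcond; apply: eq_bigr => y _.
    rewrite !inE; case: (y \in B) => //=; case: (dg B y == 2) => //=; rewrite ?andbF //.
    by case: (adj v y).
  rewrite exchange_big -sum1_card.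
  rewrite [X in _ <= X](eq_bigl (fun y => (y \in V2) && (y \notin Z))) /=; last first.
    by move=> y; rewrite in_setD andbC.
  rewrite [X in _ <= X]big_mkcondr; apply: leq_sum => y y2.
  have yB : y \in B by move: y2; rewrite in_ofdeg => /andP[].
  have -> : \sum_(v in V3) adj v y = #|ofdeg B 3 :&: nbr B y|.
    rewrite -sum1_card big_mkcond [RHS]big_mkcond; apply: eq_bigr => v _.
    rewrite in_setI -/V3; case: (boolP (v \in V3)) => // vV.
    by rewrite in_nbr V3B // adj_sym; case: (adj y v).
  case: ifPn => [_|]; last by rewrite negbK => /ZP[_]; rewrite setIC => ->; rewrite cards0.
  by apply: leq_trans (sparse y yB); apply/subset_leq_card/setIS/subsetUr.
have sV2 : V2 :\: \bigcup_(v in V3) lost v \subset ofdeg A 2 :\: V3.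
  apply/subsetP => x /setDP[x2 /bigcupP xl].
  have notlost v : v \in V3 -> x \notin f v |: nbr B (f v).
    by move=> vV; apply/negP => xv; case: xl; exists v => //; rewrite in_setI x2.
  rewrite in_setD [x \in V3]in_ofdeg; move: (x2); rewrite [x \in V2]in_ofdeg => /andP[xB /eqP->].
  rewrite xB /=; apply: V2A => //.
    by apply/imsetP => -[v vV e]; move: (notlost v vV); rewrite e setU11.
  apply/pred0P => y /=; apply/negP => /andP[yx /imsetP[v vV e]].
  by move: (notlost v vV); rewrite -e in_setU1 (mem_nbrC xB yx) orbT.
have lostle : #|\bigcup_(v in V3) lost v| <= #|V2 :\: Z|.
  apply: leq_trans card_nbrV2; apply: leq_trans (card_bigcup_leq _ _) _.
  exact: leq_sum.
have sV3 : V3 \subset ofdeg A 2.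
  by apply/subsetP => v vV; rewrite in_ofdeg V3A // dV3.
have := subset_leq_card sV2; have := cardsID V3 (ofdeg A 2).
rewrite (setIidPr sV3) => <-; rewrite leq_add2l; apply: leq_trans.
have := cardsID Z V2; rewrite (setIidPr sZ).
have := cardsID (\bigcup_(v in V3) lost v) V2.
have := subset_leq_card (subsetIr V2 (\bigcup_(v in V3) lost v)).
move: lostle; clear; lia.
Qed.

(** A deletion costs 2, which a closed neighbourhood with two vertices of degree 3 repays. In the
    sparse case deleting [V3] costs 2 [#|V3|] and leaves paths and cycles, whose cost is the number
    of their vertices of degree 2; [ofdeg2_induced] absorbs that number and one [#|V3|]. *)
Lemma star_del_maxrep B : {in B, forall x, dg B x <= 3} ->
  exists A, [/\ A \subset B, {in A, forall x, dg A x <= 2} &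
    star_del B 2 (#|ofdeg A 2| + #|ofdeg B 3|)].
Proof.
have [n] := ubnP #|B|; elim: n B => // n IHn B ltB dB.
have [/exists_inP[x xB big]|/exists_inPn sparse] :=
  boolP [exists x in B, 1 < #|ofdeg B 3 :&: (x |: nbr B x)|].
  have [||A [sA dA delA]] := IHn (B :\ x).
  - by move: ltB; rewrite (cardsD1 x B) xB.
  - move=> y /setD1P[_ yB]; apply: leq_trans (dB y yB); apply/dgS/subsetDl.
  exists A; split=> //; first by apply: subset_trans sA (subsetDl _ _).
  have := star_del1 xB delA; apply: star_del_leq.
  by rewrite -(ofdeg3_del1 dB xB) -addnA !leq_add2l.
have [x xB|A [sA dA leA]] := ofdeg2_induced dB; first by rewrite leqNgt sparse.
exists A; split=> //; set V3 := ofdeg B 3 in leA *.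
have sV3 : V3 \subset B by apply/subsetP => x; rewrite in_ofdeg => /andP[].
have d2 : {in B :\: V3, forall x, dg (B :\: V3) x <= 2}.
  move=> x /setDP[xB]; rewrite in_ofdeg xB /= => d3.
  apply: leq_trans (dgS x (subsetDl B V3)) _.
  by have := dB x xB; rewrite leq_eqVlt (negPf d3).
have : star_del (B :\: V3) 2 #|ofdeg (B :\: V3) 2|.
  rewrite -pot_gt1 //; apply: star_del_maxdeg2 => // i j leij.
  by case: (ltnP 1 i) => // lt1i; rewrite (leq_trans lt1i).
move/(star_del_setD sV3); apply: star_del_leq; move: leA; clear; lia.
Qed.

(** * Deletion bound for [rep] *)

Definition leafy B : {set G} :=
  [set v in ofdeg B 3 | [exists y in nbr B v, dg B y == 1]].

Lemma leafyP B v : reflect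
  [/\ v \in B, dg B v = 3 & exists2 y, y \in nbr B v & dg B y = 1] (v \in leafy B).
Proof.
rewrite [v \in leafy B]inE in_ofdeg; apply: (iffP andP).
  by case=> /andP[vB /eqP d3] /exists_inP[y yv /eqP d1]; split=> //; exists y.
by case=> vB d3 [y yv d1]; rewrite vB d3; split=> //; apply/exists_inP; exists y; rewrite ?d1.
Qed.

(** One leaf is deleted at each leafy vertex. A leaf has a single neighbour, so each leafy vertex
    drops to degree exactly 2 and no other surviving degree changes. *)
Lemma ofdeg2_leafy_induced B : exists2 A : {set G}, A \subset B &
  #|ofdeg B 2| + #|leafy B| <= #|ofdeg A 2|.
Proof.
have [f fP] : exists f : G -> G,
    {in leafy B, forall v, (f v \in nbr B v) && (dg B (f v) == 1)}.
  exists (fun v => odflt v [pick y in nbr B v | dg B y == 1]) => v /leafyP[_ _ [y yv d1]].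
  by case: pickP => [z|/(_ y)] //=; rewrite yv d1.
pose D := f @: leafy B; pose A := B :\: D.
have DP y v : y \in D -> y \in nbr B v -> v \in B -> v \in leafy B /\ y = f v.
  move=> /imsetP[w wL ->] fv vB; have /andP[fw /eqP d1] := fP w wL.
  have wB : w \in B by case/leafyP: wL.
  have : v \in [set w] by rewrite -(dg1_nbr d1 (mem_nbrC wB fw)) mem_nbrC.
  by move/set1P->.
have dD x : x \in D -> dg B x = 1 by case/imsetP => v /fP/andP[_ /eqP d1] ->.
exists A; first exact: subsetDl.
have sL : leafy B \subset ofdeg A 2.
  apply/subsetP => v vL; have [vB d3 _] := leafyP B v vL.
  have /andP[fv _] := fP v vL; have vA : v \in A.
    by rewrite inE vB andbT; apply/negP => /dD; rewrite d3.
  rewrite in_ofdeg vA; move: d3; rewrite /dg (cardsD1 (f v)) fv => -[/esym d2].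
  apply/eqP; rewrite {}d2; congr #|pred_of_set _|; apply/setP => y.
  rewrite in_nbr [y \in A]in_setD in_setD1 -andbA -in_nbr.
  have [yv|] := boolP (y \in nbr B v); rewrite ?andbF // !andbT; congr (~~ _).
  by apply/idP/eqP => [yD|->]; [case: (DP y v yD yv vB) | apply: imset_f].
have s2 : ofdeg B 2 \subset ofdeg A 2 :\: leafy B.
  apply/subsetP => x; rewrite in_ofdeg => /andP[xB /eqP d2].
  have xL : x \notin leafy B by apply/negP => /leafyP[_]; rewrite d2.
  have xA : x \in A by rewrite inE xB andbT; apply/negP => /dD; rewrite d2.
  rewrite in_setD xL in_ofdeg xA -d2 /=; apply/eqP; congr #|pred_of_set _|.
  apply/setP => y; rewrite in_nbr [y \in A]in_setD -andbA -in_nbr.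
  have [yx|] := boolP (y \in nbr B x); rewrite ?andbF // andbT.
  by apply/negP => yD; case: (DP y x yD yx xB); rewrite (negPf xL).
by rewrite -(cardsID (leafy B) (ofdeg A 2)) (setIidPr sL) addnC leq_add2l subset_leq_card.
Qed.

Lemma sum_nbr B v (F : nat -> nat) : v \in B -> {in B, forall x, dg B x <= 3} ->
  \sum_(x in nbr B v) F (dg B x) =
    #|nbr B v :&: ofdeg B 1| * F 1 + #|nbr B v :&: ofdeg B 2| * F 2
      + #|nbr B v :&: ofdeg B 3| * F 3.
Proof.
move=> vB dB; have E d : #|nbr B v :&: ofdeg B d| = \sum_(x in nbr B v) (dg B x == d).
  rewrite -sum1_card (eq_bigl (fun x => (x \in nbr B v) && (dg B x == d))) => [|x].
    by rewrite big_mkcondr; apply: eq_bigr => x _; case: (_ == _).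
  by rewrite in_setI in_ofdeg in_nbr; case: (x \in B); case: (adj v x).
rewrite !E !big_distrl -!big_split /=; apply: eq_bigr => x xv.
have xB : x \in B by move: xv; rewrite in_nbr => /andP[].
have := dB x xB; have := dg_gt0 (mem_nbrC vB xv).
by case: (dg B x) => [|[|[|[|d]]]] // _ _; rewrite !eqxx /=; lia.
Qed.

Definition cubic_sparse B : Prop :=
  {in B, forall x, dg B x <= 3} /\
  {in B, forall x, #|ofdeg B 3 :&: (x |: nbr B x)| <= 2}.

Lemma cubic_sparseS A B : A \subset B -> cubic_sparse B -> cubic_sparse A.
Proof.
move=> sAB [dB sB]; have sub := subsetP sAB; split=> x xA.
  by apply: leq_trans (dgS x sAB) (dB x (sub x xA)).
apply: leq_trans (sB x (sub x xA)); apply/subset_leq_card/setISS.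
  apply/subsetP => y; rewrite !in_ofdeg => /andP[yA /eqP d3]; rewrite sub //=.
  by rewrite eqn_leq dB ?sub // -d3 dgS.
exact/setUS/nbrS.
Qed.

(** A new leaf is a neighbour of [v] that had degree 2, and it has only one other neighbour to make
    leafy. *)
Lemma leafy_del1 B v : {in B, forall x, dg B x <= 3} -> v \in B ->
  #|leafy (B :\ v)| <= #|leafy B| + #|nbr B v :&: ofdeg B 2|.
Proof.
move=> dB vB; set K := nbr B v :&: ofdeg B 2.
have sub : leafy (B :\ v) \subset leafy B :|: \bigcup_(w in K) nbr (B :\ v) w.
  apply/subsetP => u /leafyP[uBv d3 [y yu d1]].
  have uB : u \in B by case/setD1P: uBv.
  have yB : y \in B by move: yu; rewrite nbrD1 in_setD1 in_nbr => /and3P[].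
  have yv : y != v by move: yu; rewrite nbrD1 in_setD1 => /andP[].
  have d3' : dg B u = 3.
    by apply/eqP; rewrite eqn_leq dB // -d3 dgS // subsetDl.
  have yuB : y \in nbr B u by move: yu; rewrite nbrD1 in_setD1 => /andP[].
  rewrite in_setU; have [d1'|d1'] := eqVneq (dg B y) 1.
    by apply/orP; left; apply/leafyP; split=> //; exists y.
  apply/orP; right; apply/bigcupP; exists y; last by rewrite (mem_nbrC uBv).
  rewrite in_setI in_nbr in_ofdeg yB /=; move: d1 d1'; rewrite dgD1 // adj_sym.
  have := dg_gt0 (mem_nbrC uB yuB).
  by case: (adj v y); case: (dg B y) => [|[|[|d]]].
apply: leq_trans (subset_leq_card sub) _; apply: leq_trans (leq_card_setU _ _) _.
rewrite leq_add2l -[#|K|]sum1_card; apply: leq_trans (card_bigcup_leq _ _) _.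
apply: leq_sum => w; rewrite in_setI in_nbr in_ofdeg.
move=> /andP[/andP[_ vw] /andP[_ /eqP d2]].
by rewrite -/(dg _ w) dgD1 // d2 adj_sym vw.
Qed.

(* 32 t is bounded by the total weight, with weights 0, 2, 14, 14 for the degrees
   0, 1, 2, 3, plus 3 for each vertex of degree 3 with a leaf neighbour.  The path on
   4 vertices is tight. *)
Definition wt (d : nat) : nat := 2 * (0 < d) + 12 * (1 < d).

Lemma wt_homo : {homo wt : i j / i <= j}.
Proof. by rewrite /wt => i j; lia. Qed.

Lemma leafy_closed B S : {in S, forall x, nbr B x \subset S} ->
  #|leafy (B :\: S)| <= #|leafy B|.
Proof.
move=> clS; apply/subset_leq_card/subsetP => v.
have dE x : x \in B -> x \notin S -> nbr (B :\: S) x = nbr B x.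
  move=> xB xS; apply/setP => y; rewrite in_nbr in_setD -andbA -in_nbr.
  have [yx|] := boolP (y \in nbr B x); rewrite ?andbF // andbT.
  by apply: contra xS => /clS/subsetP; apply; apply: mem_nbrC yx.
case/leafyP => /setDP[vB vS] d3 [y yv d1]; apply/leafyP; split=> //.
  by rewrite -d3 /dg dE.
move: yv; rewrite dE // => yv; exists y => //; rewrite -d1 /dg dE //.
  by move: yv; rewrite in_nbr => /andP[].
by apply: contra vS => /clS/subsetP; apply; apply: mem_nbrC yv.
Qed.

(** Vertices of degree 3 with neighbours of degree 2 are deleted first. Afterwards a component
    containing a vertex of degree 3 is a star with three leaves, or two such vertices joined by an
    edge with two leaves each. Graphs of maximum degree 2 fall under [star_del_maxdeg2]. *)
Lemma star_del_cubic_sparse B : cubic_sparse B ->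
  star_del B 32 (pot wt B + 3 * #|leafy B|).
Proof.
have [n] := ubnP #|B|; elim: n B => // n IHn B ltB csB; have [dB sB] := csB.
have IHD S : S \subset B -> S != set0 ->
    star_del (B :\: S) 32 (pot wt (B :\: S) + 3 * #|leafy (B :\: S)|).
  move=> sSB S0; apply: IHn; last by apply: cubic_sparseS csB; apply: subsetDl.
  rewrite -ltnS; apply: leq_trans ltB; rewrite ltnS.
  by rewrite -(cardsID S B) (setIidPr sSB) -[X in X < _]add0n ltn_add2r card_gt0.
have IH1 v : v \in B -> star_del B 32 (pot wt (B :\ v) + 3 * #|leafy (B :\ v)| + 32).
  move=> vB; apply: (star_del1 vB); apply: (IHD [set v]); rewrite ?sub1set //.
  by apply/set0Pn; exists v; rewrite set11.
pose k v d := #|nbr B v :&: ofdeg B d|.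
have V3P v : v \in ofdeg B 3 -> v \in B /\ dg B v = 3.
  by rewrite in_ofdeg => /andP[-> /eqP].
have k3 v : v \in ofdeg B 3 -> k v 1 + k v 2 + k v 3 = 3.
  case/V3P=> vB d3; have := sum_nbr (fun _ => 1) vB dB.
  by rewrite sum1_card -/(dg B v) d3 !muln1.
have kV3 v : v \in ofdeg B 3 -> #|ofdeg B 3 :&: (v |: nbr B v)| = k v 3 + 1.
  move=> v3; rewrite setIUr (setIidPr _) ?sub1set // cardsU1.
  by rewrite in_setI in_nbr adj_irrefl !andbF addnC setIC.
have k3le v : v \in ofdeg B 3 -> k v 3 <= 1.
  by move=> v3; have [/sB] := V3P v v3; rewrite kV3 // addn1 ltnS.
(* Neighbours of degree 3 contribute nothing, since degrees 2 and 3 have the same weight. *)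
have potd v : v \in ofdeg B 3 -> pot wt (B :\ v) + 14 + k v 1 * 2 + k v 2 * 12 = pot wt B.
  case/V3P=> vB d3; rewrite -(pot_del1 wt_homo vB) d3.
  by rewrite (sum_nbr (fun d => wt d - wt d.-1) vB dB) /wt /= !muln0 addn0 -!addnA.
(* Each neighbour of degree 2 yields 12 and creates at most one leafy vertex, at a cost of 3. The
   net gain is at least 14 + 2 * 9 = 32. *)
have [/exists_inP[v v3 big]|/exists_inPn k2le] := boolP [exists v in ofdeg B 3, 1 < k v 2].
  have [vB _] := V3P v v3; have := IH1 v vB; apply: star_del_leq.
  have := leafy_del1 dB vB; have := potd v v3; rewrite -/(k v 2).
  by move: big; clear; lia.
(* Now every vertex of degree 3 has a leaf neighbour, so each one that is lost also repays 3. The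
   gain is 14 + 12 + 2 [k v 1] + 3 ([k v 3] + 1), which is 33 or 34. *)
have [/exists_inP[v v3 /eqP one]|/exists_inPn no2] := boolP [exists v in ofdeg B 3, k v 2 == 1].
  have [vB _] := V3P v v3; have := IH1 v vB; apply: star_del_leq.
  have leafyE : leafy B = ofdeg B 3.
    apply/setP => u; apply/leafyP/idP => [[uB d3 _]|u3]; first by rewrite in_ofdeg uB d3.
    have [uB d3] := V3P u u3; split=> //.
    have : 0 < k u 1.
      by have := k3 u u3; have := k3le u u3; have := k2le u u3; clear; lia.
    by move=> /card_gt0P[y]; rewrite in_setI in_ofdeg => /and3P[yu _ /eqP]; exists y.
  have : #|leafy (B :\ v)| <= #|ofdeg (B :\ v) 3|.
    by apply/subset_leq_card/subsetP => u /leafyP[uB d3 _]; rewrite in_ofdeg uB d3.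
  have := ofdeg3_del1 dB vB; rewrite kV3 // leafyE; have := potd v v3.
  by have := k3 v v3; have := k3le v v3; move: one; clear; lia.
have k20 v : v \in ofdeg B 3 -> k v 2 = 0.
  by move=> v3; have := no2 v v3; have := k2le v v3; case: (k v 2) => [|[]].
have nbrP v y : v \in ofdeg B 3 -> y \in nbr B v -> dg B y = 1 \/ y \in ofdeg B 3.
  move=> v3 yv; have /andP[yB _] : (y \in B) && adj v y by rewrite -in_nbr.
  have [vB _] := V3P v v3; rewrite in_ofdeg yB /=.
  have d2 : dg B y != 2.
    apply/eqP => d2; have /eqP := k20 v v3; rewrite cards_eq0 => /eqP/setP/(_ y).
    by rewrite in_setI yv in_ofdeg yB d2 inE.
  have := dB y yB; have := dg_gt0 (mem_nbrC vB yv).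
  by move: d2; case: (dg B y) => [|[|[|[|d]]]] // _ _ _; [left|right].
have [/exists_inP[v v3]|/exists_inPn noV3] := boolP [exists v in ofdeg B 3, true]; last first.
  have d2 : {in B, forall x, dg B x <= 2}.
    move=> x xB; have := dB x xB; rewrite leq_eqVlt => /predU1P[d3|//].
    by have := noV3 x; rewrite in_ofdeg xB d3 => /(_ isT).
  apply: star_del_leq (star_del_maxdeg2 wt_homo _ _ d2) => //; exact: leq_addr.
move=> _; have [vB d3] := V3P v v3.
have potN : \sum_(x in v |: nbr B v) wt (dg B x) = 14 + k v 1 * 2 + k v 3 * 14.
  rewrite big_setU1 ?in_nbr ?adj_irrefl ?andbF //= d3 (sum_nbr wt vB dB).
  by rewrite -/(k v 2) k20 // /wt /= addn0 -addnA.
have nbrB x : nbr B x \subset B by apply/subsetP => y; rewrite in_nbr => /andP[].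
have leafN x y : x \in ofdeg B 3 -> y \in nbr B x -> dg B y = 1 -> nbr B y = [set x].
  by move=> x3 yx d1; apply: dg1_nbr d1 (mem_nbrC _ yx); case: (V3P x x3).
(* For a union [S] of components, the weight of the closed neighbourhood of [v] alone is enough to
   pay. *)
have closed S U p : S \subset B -> v |: nbr B v \subset S -> U \subset S -> star_forest U ->
    {in S, forall x, nbr B x \subset S} -> 32 * #|S :\: U| <= p ->
    p <= \sum_(x in v |: nbr B v) wt (dg B x) ->
    star_del B 32 (pot wt B + 3 * #|leafy B|).
  move=> sSB sNS sUS fU clS leU lep.
  have S0 : S != set0 by apply/set0Pn; exists v; apply: (subsetP sNS); rewrite setU11.
  have clU : {in U, forall u, nbr B u \subset S} by move=> u /(subsetP sUS)/clS.
  have := star_del_closed sSB sUS fU clU (IHD S sSB S0); apply: star_del_leq.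
  have := leafy_closed clS; have := pot_del wt_homo sSB.
  rewrite [\sum_(x in S) _](big_setID (v |: nbr B v)) /= (setIidPr sNS).
  by move: leU lep; clear; lia.
have leafP x y : x \in ofdeg B 3 -> y \in nbr B x -> y \notin ofdeg B 3 -> nbr B y = [set x].
  by move=> x3 yx y3; case: (nbrP x y x3 yx) => [|y3']; [apply: leafN | rewrite y3' in y3].
have [k30|] := posnP (k v 3).
  have leafv y : y \in nbr B v -> nbr B y = [set v].
    move=> yv; apply: leafP => //; apply/negP => y3.
    by move/eqP: k30; rewrite cards_eq0 => /eqP/setP/(_ y); rewrite in_setI yv y3 inE.
  apply: (closed _ _ 0 _ (subxx _) (subxx _));
    rewrite ?setDv ?cards0 ?subUset ?sub1set ?vB ?nbrB //.
    move=> x y /setU1P xP /setU1P yP xy.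
    have leaf z : z \in nbr B v -> dg (v |: nbr B v) z <= 1.
      have sub : v |: nbr B v \subset B by rewrite subUset sub1set vB nbrB.
      by move=> zv; apply: leq_trans (dgS z sub) _; rewrite /dg leafv ?cards1.
    case: xP xy => [->|/leaf-> //]; case: yP => [->|/leaf->]; rewrite ?orbT //.
    by rewrite adj_irrefl.
  by move=> x /setU1P[->|/leafv->]; rewrite ?subsetUr // sub1set setU11.
case/card_gt0P => w; rewrite in_setI => /andP[wv w3].
have [wB dw] := V3P w w3; have vw := mem_nbrC vB wv.
have uniq x y z : x \in ofdeg B 3 -> y \in ofdeg B 3 -> z \in ofdeg B 3 ->
    y \in nbr B x -> z \in nbr B x -> y = z.
  move=> x3 y3 z3 yx zx; apply: (card_le1_eqP (k3le x x3)); by rewrite in_setI ?yx ?zx.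
have leafS a b x : a \in ofdeg B 3 -> b \in ofdeg B 3 -> b \in nbr B a ->
    x \in nbr B a -> x != b -> nbr B x = [set a].
  move=> a3 b3 ba xa; apply: contraNeq => /eqP nx; apply/eqP/(uniq a) => //.
  by apply: contra_notT nx => x3; apply: leafP.
(* The double star with centres [v] and [w]. Deleting [v] costs 32, which is the weight 14 + 2 * 2 +
   14 of its closed neighbourhood. *)
pose S := nbr B v :|: nbr B w.
have sNS : v |: nbr B v \subset S by rewrite subUset sub1set in_setU vw orbT subsetUl.
have sSB : S \subset B by rewrite subUset !nbrB.
have SP x : x \in S -> [\/ x = v, x = w, nbr B x = [set v] | nbr B x = [set w]].
  have [->|xv] := eqVneq x v; first by constructor 1.
  have [->|xw] := eqVneq x w; first by constructor 2.
  by case/setUP => xN; [constructor 3; apply: (leafS v w) | constructor 4; apply: (leafS w v)].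
have vS : v \in S by rewrite in_setU vw orbT.
have wS : w \in S by rewrite in_setU wv.
apply: (closed S (S :\ v) 32) => //; rewrite ?subD1set //.
- have leaf x : x \in S :\ v -> x = w \/ dg (S :\ v) x <= 1.
    have sub : S :\ v \subset B by apply: subset_trans sSB; apply: subD1set.
    case/setD1P=> xv /SP[e|->|e|e]; [by rewrite e eqxx in xv | by left | |]; right;
      by apply: leq_trans (dgS x sub) _; rewrite /dg e cards1.
  move=> x y /leaf[->|-> //] /leaf[->|->]; rewrite ?orbT //.
  by rewrite adj_irrefl.
- by move=> x /SP[->|->|->|->]; rewrite ?subsetUl ?subsetUr ?sub1set.
- have -> : S :\: (S :\ v) = [set v].
    apply/setP => x; rewrite !in_setD !in_set1; have [->|] := eqVneq x v; first by rewrite vS.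
    by case: (x \in S).
  by rewrite cards1.
rewrite potN; have := k3 v v3; rewrite k20 //; have := k3le v v3.
have : 0 < k v 3 by apply/card_gt0P; exists w; rewrite in_setI wv.
by clear; lia.
Qed.

(** Deleting a vertex whose closed neighbourhood has three vertices of degree 3 gains 1 + 6 * 3,
    more than 16. In the sparse case the weighted bound is halved, and the leafy term is absorbed by
    [ofdeg2_leafy_induced]. *)
Lemma star_del_rep B : {in B, forall x, dg B x <= 3} ->
  exists2 A : {set G}, A \subset B &
    star_del B 16 (#|B| + 6 * #|ofdeg A 2| + 6 * #|ofdeg B 3|).
Proof.
have [n] := ubnP #|B|; elim: n B => // n IHn B ltB dB.
have [/exists_inP[x xB big]|/exists_inPn sparse] :=
  boolP [exists x in B, 2 < #|ofdeg B 3 :&: (x |: nbr B x)|].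
  have [||A sA delA] := IHn (B :\ x).
  - by move: ltB; rewrite (cardsD1 x B) xB.
  - move=> y /setD1P[_ yB]; apply: leq_trans (dB y yB); apply/dgS/subsetDl.
  exists A; first by apply: subset_trans sA (subsetDl _ _).
  have := star_del1 xB delA; apply: star_del_leq.
  rewrite -(ofdeg3_del1 dB xB) (cardsD1 x B) xB; move: big; clear; lia.
have csB : cubic_sparse B by split=> // x xB; rewrite leqNgt sparse.
have [A sA leA] := ofdeg2_leafy_induced B; exists A => //.
have [W [sW fW leW]] := star_del_cubic_sparse csB; exists W; split=> //.
have : pot wt B <= 2 * #|B| + 12 * #|ofdeg B 2| + 12 * #|ofdeg B 3|.
  have E d : #|ofdeg B d| = \sum_(x in B) (dg B x == d).
    rewrite -sum1_card (eq_bigl _ _ (in_ofdeg B d)) big_mkcondr.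
    by apply: eq_bigr => x _; case: (_ == _).
  rewrite !E -sum1_card !big_distrr -!big_split /=.
  apply: leq_sum => x xB; have := dB x xB; rewrite /wt.
  by case: (dg B x) => [|[|[|[|d]]]].
by move: leW leA; clear; lia.
Qed.

End InducedDegrees.

(* The case [b = true] is about [maxrep], the case [b = false] about [rep]. *)
Definition degree_capped (b : bool) (G : sgraph) (t : nat -> nat) : Prop :=
  forall (A : {set G}) d,
    (b -> {in A, forall x, dg A x <= d}) -> #|ofdeg A d| <= t d.

Definition repetition (b : bool) : sgraph -> nat := if b then maxrep else rep.

(** * Repetition numbers as caps on degree counts *)

Section InducedRepetition.
Variable G : sgraph.
Implicit Types (A : {set G}).

Lemma deg_dg (x : G) : deg x = dg setT x.
Proof. by apply: eq_card => y; rewrite in_nbr !inE. Qed.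

Lemma maxdegP d : reflect (forall x : G, dg setT x <= d) (maxdeg G <= d).
Proof.
rewrite /maxdeg; apply: (iffP (bigmax_leqP _ _ _)) => [le x|le x _]; first by rewrite -deg_dg le.
by rewrite deg_dg.
Qed.

Lemma dg_maxdeg A x d : maxdeg G <= d -> dg A x <= d.
Proof. by move=> /maxdegP/(_ x); apply: leq_trans; apply/dgS/subsetT. Qed.

Lemma deg_induced A (x : induced A) : deg x = dg A (val x).
Proof.
rewrite /deg /dg -(card_imset _ val_inj); apply: eq_card => y; rewrite in_nbr.
apply/imsetP/andP => [[z]|[yA xy]]; first by rewrite inE /= => xz ->; split=> //; apply: valP.
by exists (Sub y yA); rewrite ?inE ?SubK.
Qed.

Lemma card_deg_induced A d : #|[set x : induced A | deg x == d]| = #|ofdeg A d|.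
Proof.
rewrite -(card_imset _ val_inj); apply: eq_card => y; rewrite in_ofdeg.
apply/imsetP/andP => [[z]|[yA dy]].
  by rewrite inE deg_induced => dz ->; split=> //; apply: valP.
by exists (Sub y yA); rewrite ?inE ?deg_induced ?SubK.
Qed.

(** For [maxrep], a vertex of degree [d] in a set whose degrees are at most [d] forces the maximum
    degree to be [d]; otherwise the count is 0. *)
Lemma repetition_leP b m :
  (forall A, repetition b (induced A) <= m) <-> degree_capped b G (fun=> m).
Proof.
split=> [le A d|cap A].
  case: b le => /= le dA; last first.
    apply: leq_trans (le A); rewrite -card_deg_induced.
    apply: (leq_bigmax_cond (F := fun B : {set induced A} => #|B|)).
    apply/forall_inP => x; rewrite inE => /eqP ->.
    by apply/forall_inP => y; rewrite inE => /eqP ->.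
  have [->|[x]] := set_0Vmem (ofdeg A d); first by rewrite cards0.
  rewrite in_ofdeg => /andP[xA /eqP dx]; apply: leq_trans (le A).
  suff e : maxdeg (induced A) = d by rewrite /maxrep e card_deg_induced.
  apply/eqP; rewrite eqn_leq; apply/andP; split.
    by apply/bigmax_leqP => y _; rewrite deg_induced dA //; apply: valP.
  by rewrite -dx -(deg_induced (Sub x xA)); apply: (leq_bigmax (F := @deg _)).
case: b cap => cap /=; last first.
  apply/bigmax_leqP => B /forall_inP sameB.
  have [->|[x xB]] := set_0Vmem B; first by rewrite cards0.
  apply: leq_trans (cap A (deg x) _) => //; rewrite -card_deg_induced.
  apply/subset_leq_card/subsetP => y yB; rewrite inE eq_sym.
  by move/forall_inP: (sameB x xB); apply.
rewrite /maxrep card_deg_induced; apply: cap => _ x xA.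
by rewrite -(deg_induced (Sub x xA)); apply: (leq_bigmax (F := @deg _)).
Qed.

End InducedRepetition.

(** * Upper bounds on the order of a capped graph *)

Section UpperBound.
Variables (G : sgraph) (m : nat).
Hypothesis G3 : maxdeg G <= 3.

Lemma capped_star_forest b (W : {set G}) :
  degree_capped b G (fun=> m) -> star_forest W -> 2 * #|W| <= 3 * m.
Proof.
move=> cap /star_forest_split[I [J [_ _ dI dJ leW]]].
have cI : #|I| <= m.
  rewrite (_ : I = ofdeg I 0); first by apply: cap => _ x /dI->.
  by apply/setP => x; rewrite in_ofdeg; case: (boolP (x \in I)) => // /dI->.
have cJ : #|J| <= m.
  rewrite (_ : J = ofdeg J 1); first by apply: cap => _ x /dJ->.
  by apply/setP => x; rewrite in_ofdeg; case: (boolP (x \in J)) => // /dJ->.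
by move: leW cI cJ; clear; lia.
Qed.

Let dT : {in [set: G], forall x, dg setT x <= 3}.
Proof. by move=> x _; apply: dg_maxdeg. Qed.

Lemma capped_maxrep : degree_capped true G (fun=> m) -> 2 * #|G| <= 5 * m.
Proof.
move=> cap; have [A [_ dA [W [_ fW leW]]]] := star_del_maxrep dT.
have := capped_star_forest cap fW; have := cap A 2 (fun _ => dA).
have := cap setT 3 (fun _ => dT); have := cardsID W [set: G].
by rewrite setTI cardsT; move: leW; clear; lia.
Qed.

(** With N = [#|G|], 16 (N - |W|) <= N + 12 m and 16 |W| <= 24 m give 15 N <= 36 m. *)
Lemma capped_rep : degree_capped false G (fun=> m) -> 5 * #|G| <= 12 * m.
Proof.
move=> cap; have [A _ [W [_ fW]]] := star_del_rep dT.
have no P : false -> P by [].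
have := capped_star_forest cap fW; have := cap A 2 (no _).
have := cap setT 3 (no _); have := cardsID W [set: G].
by rewrite setTI cardsT; clear; lia.
Qed.

End UpperBound.

(** * Disjoint unions *)

Section DisjointUnion.
Variables G1 G2 : sgraph.

Definition gsum_adj : rel (G1 + G2) := fun x y =>
  match x, y with
  | inl x, inl y => adj x y
  | inr x, inr y => adj x y
  | _, _ => false
  end.

Lemma gsum_sym : symmetric gsum_adj.
Proof. by case=> x [] y //=; apply: adj_sym. Qed.

Lemma gsum_irrefl : irreflexive gsum_adj.
Proof. by case=> x /=; apply: adj_irrefl. Qed.

Definition gsum : sgraph := SGraph gsum_sym gsum_irrefl.

Lemma card_gsum_set (A : {set gsum}) : #|A| = #|inl @^-1: A| + #|inr @^-1: A|.
Proof.
rewrite -!sum1_card big_sumType /=.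
by congr (_ + _); apply: eq_bigl => x; rewrite inE.
Qed.

Lemma dg_inl (A : {set gsum}) (x : G1) :
  dg A (inl x : gsum) = dg (inl @^-1: A) x.
Proof.
rewrite /dg card_gsum_set [X in _ + X]eq_card0 ?addn0 => [|y]; last by rewrite !inE andbF.
by apply: eq_card => y; rewrite !inE.
Qed.

Lemma dg_inr (A : {set gsum}) (x : G2) :
  dg A (inr x : gsum) = dg (inr @^-1: A) x.
Proof.
rewrite /dg card_gsum_set [X in X + _]eq_card0 ?add0n => [|y]; last by rewrite !inE andbF.
by apply: eq_card => y; rewrite !inE.
Qed.

(** In the [maxrep] case [d] only has to bound the degrees, so the bound passes to both summands
    even if one has smaller maximum degree. *)
Lemma degree_capped_gsum b t1 t2 :
    degree_capped b G1 t1 -> degree_capped b G2 t2 ->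
  degree_capped b gsum (fun d => t1 d + t2 d).
Proof.
move=> cap1 cap2 A d dA; rewrite card_gsum_set; apply: leq_add.
  apply: leq_trans (cap1 (inl @^-1: A) d _).
    by apply/subset_leq_card/subsetP => x; rewrite !inE dg_inl.
  by move=> /dA{}dA x; rewrite inE => /dA; rewrite dg_inl.
apply: leq_trans (cap2 (inr @^-1: A) d _).
  by apply/subset_leq_card/subsetP => x; rewrite !inE dg_inr.
by move=> /dA{}dA x; rewrite inE => /dA; rewrite dg_inr.
Qed.

Lemma maxdeg_gsum d : maxdeg G1 <= d -> maxdeg G2 <= d -> maxdeg gsum <= d.
Proof.
move=> d1 d2; apply/maxdegP => -[x|x]; first by rewrite dg_inl dg_maxdeg.
by rewrite dg_inr dg_maxdeg.
Qed.

End DisjointUnion.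

(** The cap depends on the degree so that unbalanced components can be combined into a union with a
    constant cap. *)
Definition capped_order (b : bool) (t : nat -> nat) (n : nat) : Prop :=
  exists G : sgraph, [/\ maxdeg G <= 3, n <= #|G| & degree_capped b G t].

Lemma capped_order_add b t1 t2 n1 n2 :
    capped_order b t1 n1 -> capped_order b t2 n2 ->
  capped_order b (fun d => t1 d + t2 d) (n1 + n2).
Proof.
case=> [G1 [d1 le1 cap1]] [G2 [d2 le2 cap2]]; exists (gsum G1 G2); split.
- exact: maxdeg_gsum.
- by rewrite card_sum leq_add.
- exact: degree_capped_gsum.
Qed.

Lemma capped_order_leq b t1 t2 n :
  (forall d, t1 d <= t2 d) -> capped_order b t1 n -> capped_order b t2 n.
Proof.
move=> le [G [dG leG cap]]; exists G; split=> // A d dA.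
exact: leq_trans (cap A d dA) (le d).
Qed.

(** * Checking explicit graphs by enumeration of vertex sets *)

Section ListGraph.
Variable E : seq (seq nat).

(** The symmetric closure, so that each edge is listed only once. *)
Definition ladj (i j : nat) : bool :=
  (i != j) && ((j \in nth [::] E i) || (i \in nth [::] E j)).

Lemma ladj_sym (i j : 'I_(size E)) : ladj i j = ladj j i.
Proof. by rewrite /ladj eq_sym orbC. Qed.

Lemma ladj_irrefl (i : 'I_(size E)) : ladj i i = false.
Proof. by rewrite /ladj eqxx. Qed.

Definition lgraph : sgraph :=
  SGraph (ladj_sym : symmetric (fun i j : 'I_(size E) => ladj i j)) ladj_irrefl.

Definition ldg (s : bitseq) (i : nat) : nat :=
  count (fun j => nth false s j && ladj i j) (iota 0 (size E)).

Definition lcount (s : bitseq) (d : nat) : nat :=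
  count (fun i => nth false s i && (ldg s i == d)) (iota 0 (size E)).

Definition lexceeds (s : bitseq) (d : nat) : bool :=
  has (fun i => nth false s i && (d < ldg s i)) (iota 0 (size E)).

Fixpoint bitseqs (n : nat) : seq bitseq :=
  if n is n'.+1 then map (cons true) (bitseqs n') ++ map (cons false) (bitseqs n')
  else [:: [::]].

Lemma mem_bitseqs s : s \in bitseqs (size s).
Proof.
elim: s => //= b s IHs; rewrite mem_cat; apply/orP.
by case: b; [left|right]; apply: map_f.
Qed.

(** Degrees past the end of [t] get the default cap 0. *)
Definition lcapped (b : bool) (t : seq nat) : bool :=
  all (fun s => all (fun d => (b && lexceeds s d) || (lcount s d <= nth 0 t d))
                    (iota 0 (size E).+1))
      (bitseqs (size E)).

Definition lcubic : bool :=
  all (fun i => count (ladj i) (iota 0 (size E)) <= 3) (iota 0 (size E)).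

Lemma count_ord n (p : pred nat) : count p (iota 0 n) = #|[set i : 'I_n | p i]|.
Proof.
rewrite -sum1_count -sum1_card -[n in iota 0 n]subn0 -/(index_iota 0 n) big_mkord.
by apply: eq_bigl => i; rewrite inE.
Qed.

Section Indicator.
Variable A : {set lgraph}.

Definition indicator : bitseq := [seq i \in A | i <- enum 'I_(size E)].

Lemma nth_indicator (i : 'I_(size E)) : nth false indicator i = (i \in A).
Proof. by rewrite (nth_map i) ?size_enum_ord // nth_ord_enum. Qed.

Lemma ldg_indicator (i : 'I_(size E)) : ldg indicator i = dg A (i : lgraph).
Proof.
by rewrite /ldg /dg count_ord; apply: eq_card => j; rewrite [LHS]inE [RHS]inE nth_indicator.
Qed.

Lemma lcount_indicator d : lcount indicator d = #|ofdeg A d|.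
Proof.
rewrite /lcount count_ord; apply: eq_card => i.
by rewrite [LHS]inE [RHS]inE nth_indicator ldg_indicator.
Qed.

End Indicator.

Lemma maxdeg_lgraph : lcubic -> maxdeg lgraph <= 3.
Proof.
move=> /allP le; apply/maxdegP => i.
have := le (val i); rewrite mem_iota ltn_ord => /(_ isT); rewrite count_ord.
by congr (_ <= 3); apply: eq_card => j; rewrite [LHS]inE [RHS]inE inE.
Qed.

Lemma degree_capped_lgraph b t : lcapped b t -> degree_capped b lgraph (nth 0 t).
Proof.
move=> /allP/(_ (indicator _)) cap A d dA.
have [ltd|led] := ltnP d (size E).+1; last first.
  rewrite (_ : ofdeg A d = set0) ?cards0 //; apply/setP => x; rewrite in_ofdeg inE.
  apply/negbTE; rewrite negb_and; apply/orP; right; rewrite neq_ltn; apply/orP; left.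
  by apply: leq_trans led; rewrite ltnS; apply: leq_trans (max_card _) _; rewrite card_ord.
have mA : indicator A \in bitseqs (size E).
  by have := mem_bitseqs (indicator A); rewrite size_map size_enum_ord.
have /allP/(_ d) := cap A mA; rewrite mem_iota ltd lcount_indicator.
move=> /(_ isT)/orP[|//].
case/andP=> /dA{}dA /hasP[i]; rewrite mem_iota => /= lti.
by rewrite (nth_indicator A (Ordinal lti)) (ldg_indicator A (Ordinal lti))
  => /andP[/dA]; rewrite leqNgt => /negPf->.
Qed.

End ListGraph.

Lemma capped_order_lgraph b t E :
  lcubic E -> lcapped E b t -> capped_order b (nth 0 t) (size E).
Proof.
move=> E3 capE; exists (lgraph E); split; first exact: maxdeg_lgraph.
  by rewrite card_ord.
exact: degree_capped_lgraph.
Qed.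

(* The multiplicities of the components solve the linear program that balances the
   four degrees 0, 1, 2, 3, subject to the caps of each component. *)
Lemma capped_maxrep_53_24 : capped_order true (fun=> 24) 53.
Proof.
have K1x6 : capped_order true (nth 0 [:: 6]) 6.
  by apply: (@capped_order_lgraph _ _ (nseq 6 [::])); vm_compute.
(* Two triangles joined by an edge. *)
have G6 : capped_order true (nth 0 [:: 2; 4; 3; 2]) 6.
  by apply: (@capped_order_lgraph _ _ [:: [:: 1; 4]; [:: 4]; [:: 3; 5]; [:: 5]; [:: 5]; [::]]);
    vm_compute.
(* A triangular prism without the rung 2 - 3, with a pendant path 3 - 1 - 0. *)
have G8 : capped_order true (nth 0 [:: 3; 4; 4; 5]) 8.
  by apply: (@capped_order_lgraph _ _ [:: [:: 1]; [:: 3]; [:: 4; 5]; [:: 6; 7]; [:: 5; 6];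
    [:: 7]; [:: 7]; [::]]); vm_compute.
(* A 5-cycle joined by the edge 7 - 8 to a vertex 7 that carries a leaf and a pendant path of length
   2. *)
have G9 : capped_order true (nth 0 [:: 4; 4; 5; 2]) 9.
  by apply: (@capped_order_lgraph _ _ [:: [:: 2]; [:: 7]; [:: 7]; [:: 4; 5]; [:: 6]; [:: 8];
    [:: 8]; [:: 8]; [::]]); vm_compute.
have G8x2 := capped_order_add G8 G8; have G8x4 := capped_order_add G8x2 G8x2.
apply: capped_order_leq (capped_order_add (capped_order_add K1x6 G6) (capped_order_add G8x4 G9)).
by case=> [|[|[|[|d]]]] //=; rewrite !nth_nil.
Qed.

(** The caps of the three components add up to 6 in each of the degrees 0 to 3. *)
Lemma capped_rep_13_6 : capped_order false (fun=> 6) 13.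
Proof.
have K1K2 : capped_order false (nth 0 [:: 2; 2]) 3.
  by apply: (@capped_order_lgraph _ _ [:: [::]; [:: 2]; [::]]); vm_compute.
have P4 : capped_order false (nth 0 [:: 2; 2; 2]) 4.
  by apply: (@capped_order_lgraph _ _ [:: [:: 1]; [:: 2]; [:: 3]; [::]]); vm_compute.
have prism : capped_order false (nth 0 [:: 2; 2; 4; 6]) 6.
  by apply: (@capped_order_lgraph _ _ [:: [:: 1; 2; 3]; [:: 2; 4]; [:: 5]; [:: 4; 5]; [:: 5];
    [::]]); vm_compute.
apply: capped_order_leq (capped_order_add (capped_order_add K1K2 P4) prism).
by case=> [|[|[|[|d]]]] //=; rewrite !nth_nil.
Qed.

From mathcomp Require Import all_boot all_order all_algebra.
From mathcomp Require Import all_classical all_reals all_analysis.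
From mathcomp Require Import lra.
Import Order.TTheory GRing.Theory Num.Theory.
Import numFieldNormedType.Exports.

Local Open Scope nat_scope.

(** * Extremal functions and their superadditivity *)

Definition threshold (b : bool) (k : nat) : nat :=
  if b then h_maxrep k 3 else g_rep k 3.

Lemma threshold_forces b k : forces (repetition b) k 3 (threshold b k).
Proof.
by case: b; rewrite /threshold /h_maxrep /g_rep; case: ex_minnP => v /asboolP.
Qed.

Lemma threshold_min b k n : forces (repetition b) k 3 n -> threshold b k <= n.
Proof.
by case: b => fn; rewrite /threshold /h_maxrep /g_rep;
  case: ex_minnP => v _; apply; apply/asboolP.
Qed.

Lemma capped_order_threshold b m n :
  capped_order b (fun=> m) n -> n <= threshold b m.+1.
Proof.
case=> G [dG leG /repetition_leP cap]; rewrite leqNgt; apply/negP => ltn.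
have [A] := threshold_forces dG (leq_trans ltn leG).
by rewrite ltnNge cap.
Qed.

(** By minimality one vertex less does not force, and a counterexample is an extremal graph. For
    threshold 0 the empty graph serves. *)
Lemma threshold_capped_order b m :
  capped_order b (fun=> m) (threshold b m.+1).
Proof.
case e : (threshold b m.+1) => [|n].
  exists (lgraph [::]); split=> //; first exact: maxdeg_lgraph.
  by move=> A d _; apply: leq_trans (max_card _) _; rewrite card_ord.
apply: contrapT => noG; suff /threshold_min : forces (repetition b) m.+1 3 n.
  by rewrite e ltnn.
move=> G dG ltG; apply: contrapT => noA; apply: noG; exists G; split=> //.
by apply/repetition_leP => A; rewrite leqNgt; apply/negP => ltA; apply: noA; exists A.
Qed.

Lemma threshold_superadditive b m1 m2 :
  threshold b m1.+1 + threshold b m2.+1 <= threshold b (m1 + m2).+1.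
Proof.
by apply: capped_order_threshold; apply: capped_order_add; apply: threshold_capped_order.
Qed.

Lemma threshold_maxrep_le m : 2 * threshold true m.+1 <= 5 * m.
Proof.
have [G [dG leG /(capped_maxrep dG)]] := threshold_capped_order true m.
by move: leG; clear; lia.
Qed.

Lemma threshold_rep_le m : 5 * threshold false m.+1 <= 12 * m.
Proof.
have [G [dG leG /(capped_rep dG)]] := threshold_capped_order false m.
by move: leG; clear; lia.
Qed.

(** * Fekete's lemma with shifted index *)

Section Fekete.
Local Open Scope classical_set_scope.
Local Open Scope ring_scope.
Variables (R : realType) (a : nat -> nat) (C : R).
Hypothesis a_add : forall m n, (a m + a n <= a (m + n))%N.
Hypothesis a_le : forall m, (a m)%:R <= C * m%:R.

Let rate : set R := [set (a m)%:R / m%:R | m in [set m | (0 < m)%N]].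

Let rate_ub : ubound rate C.
Proof. by move=> _ [m m0 <-]; rewrite ler_pdivrMr ?ltr0n. Qed.

Let rate_le m : (0 < m)%N -> (a m)%:R / m%:R <= sup rate.
Proof. by move=> m0; apply: ub_le_sup; [exists C | exists m]. Qed.

Lemma superadditive_mul q m : (q * a m <= a (q * m))%N.
Proof.
by elim: q => // q IHq; rewrite !mulSn; apply: leq_trans (a_add _ _); rewrite leq_add2l.
Qed.

(** With q the quotient of k - 1 by m, k <= (q + 1) m and q a(m) <= a(k - 1). *)
Lemma superadditive_pred_rate m k : (0 < m)%N -> (0 < k)%N ->
  (a m)%:R / m%:R - (a m)%:R / k%:R <= (a k.-1)%:R / k%:R :> R.
Proof.
move=> m0 k0; rewrite lerBlDr -mulrDl ler_pdivlMr ?ltr0n // mulrAC ler_pdivrMr ?ltr0n //.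
rewrite -natrD -!natrM ler_nat.
have lek : (k <= (k.-1 %/ m).+1 * m)%N by rewrite -{1}(prednK k0) ltn_ceil.
apply: leq_trans (leq_mul (leqnn _) lek) _; rewrite mulnA leq_mul2r; apply/orP; right.
rewrite mulnC mulSn addnC leq_add2r; apply: leq_trans (superadditive_mul _ _) _.
rewrite {2}(divn_eq k.-1 m); apply: leq_trans (a_add _ _); exact: leq_addr.
Qed.

Lemma fekete_cvg : (fun k => (a k.-1)%:R / k%:R : R) @ \oo --> sup rate.
Proof.
have rate0 : rate !=set0 by exists ((a 1)%:R / 1%:R); exists 1%N.
(* For k = 0 the quotient is 0 by convention. For k = 1, superadditivity forces [a 0] to vanish. *)
have ule k : (a k.-1)%:R / k%:R <= sup rate.
  case: k => [|[|k]].
  - by rewrite invr0 mulr0; apply: le_trans (rate_le (ltn0Sn 0)); rewrite divr_ge0.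
  - have := a_add 0 0; case: (a 0%N) => [_|n]; last by lia.
    by rewrite mul0r; apply: le_trans (rate_le (ltn0Sn 0)); rewrite divr_ge0.
  apply: le_trans (rate_le (ltn0Sn k)); rewrite ler_wpM2l // lef_pV2 ?posrE ?ltr0n //.
  by rewrite ler_nat.
apply/cvgrPdist_le => e e0.
have e20 : 0 < e / 2%:R by rewrite divr_gt0 ?ltr0n.
have [_ [m m0 <-] ltm] : exists2 x, rate x & sup rate - e / 2%:R < x.
  by apply: sup_adherent => //; split=> //; exists C.
near=> k.
have k0 : (0 < k)%N by near: k; exists 1%N.
rewrite ger0_norm ?subr_ge0 ?ule //.
have lek : (a m)%:R / k%:R <= e / 2%:R.
  rewrite ler_pdivrMr ?ltr0n // mulrC -ler_pdivrMr //.
  by near: k; exact: nbhs_infty_ger.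
have := superadditive_pred_rate m0 k0.
move: ltm lek; set x := _ / m%:R; set y := _ / k%:R; set z := _ / k%:R => /= *; lra.
Unshelve. all: by end_near. Qed.

Lemma fekete_ge m : (0 < m)%N -> (a m)%:R / m%:R <= sup rate.
Proof. exact: rate_le. Qed.

Lemma fekete_le : sup rate <= C.
Proof. by apply: ge_sup rate_ub; exists ((a 1)%:R / 1%:R); exists 1%N. Qed.

End Fekete.

(** * The limits and their bounds *)

Local Open Scope classical_set_scope.
Local Open Scope ring_scope.

(** The limit is a supremum of rates, so one graph of order at least [n0] with constant cap [m0]
    bounds it from below. *)
Lemma threshold_rate_cvg (R : realType) b m0 n0 (p q : nat) :
    (0 < m0)%N -> (0 < q)%N -> capped_order b (fun=> m0) n0 ->
    (forall m, q * threshold b m.+1 <= p * m)%N ->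
  let u : R ^nat := fun k : nat => (threshold b k)%:R / k%:R in
  cvgn u /\ n0%:R / m0%:R <= limn u <= p%:R / q%:R.
Proof.
move=> m00 q0 cap le u; pose a m := threshold b m.+1.
have aC m : (a m)%:R <= (p%:R / q%:R) * m%:R :> R.
  by rewrite mulrAC ler_pdivlMr ?ltr0n // -!natrM ler_nat mulnC le.
have := fekete_cvg (threshold_superadditive b) aC.
have -> : (fun k => (a k.-1)%:R / k%:R : R) = u.
  by apply/funext => -[|k] //; rewrite /u invr0 !mulr0.
move=> cvgu; split; first by apply/cvg_ex; eexists; exact: cvgu.
rewrite (cvg_lim _ cvgu) //; apply/andP; split; last exact: fekete_le.
apply: le_trans (fekete_ge aC m00).
by rewrite ler_wpM2r ?invr_ge0 // ler_nat; apply: capped_order_threshold.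
Qed.

Theorem theorem3 (R : realType) :
  let uh : R ^nat := fun k : nat => (h_maxrep k 3)%:R / k%:R in
  let ug : R ^nat := fun k : nat => (g_rep k 3)%:R / k%:R in
  [/\ cvgn uh, cvgn ug,
      53%:R / 24%:R <= limn uh <= 5%:R / 2%:R &
      13%:R / 6%:R <= limn ug <= 12%:R / 5%:R].
Proof.
have [//|//|cvgh limh] :=
  @threshold_rate_cvg R true 24 53 5 2 _ _ capped_maxrep_53_24 threshold_maxrep_le.
have [//|//|cvgg limg] :=
  @threshold_rate_cvg R false 6 13 12 5 _ _ capped_rep_13_6 threshold_rep_le.
by split.
Qed.
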